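(* Let $f(n)$ denote the minimum, over all tournaments $T_n$ on $n$ vertices, of the maximum number of pairwise edge-disjoint transitive triples contained in $T_n$. Then $f(n) > 0.13\,n^2(1+o(1))$; that is, there is a function $\varepsilon(n)\to 0$ as $n\to\infty$ such that $f(n) > 0.13\,n^2(1+\varepsilon(n))$ for all sufficiently large $n$.
   Context: A tournament on $n$ vertices is an orientation of the complete graph $K_n$: for every two distinct vertices $x,y$ exactly one of $(x,y)$, $(y,x)$ is an edge. A transitive triple ($TT_3$) is a set of three edges of the form $\{(x,y),(x,z),(y,z)\}$. Transitive triples are edge-disjoint if no directed edge belongs to two of them. *)

(* Defs.v *)
From HB Require Import structures.
From mathcomp Require Import all_boot.

Set Implicit Arguments.
Unset Strict Implicit.
Unset Printing Implicit Defensive.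

Local Open Scope nat_scope.

(* A digraph on the vertex set 'I_n is given by its set T of directed edges. *)
Definition is_tournament (n : nat) (T : {set 'I_n * 'I_n}) : bool :=
  [forall x, (x, x) \notin T] &&
  [forall x, forall y, (x != y) ==> (((x, y) \in T) (+) ((y, x) \in T))].

Definition is_TT3 (n : nat) (A : {set 'I_n * 'I_n}) : bool :=
  [exists x, exists y, exists z,
     uniq [:: x; y; z] && (A == [set (x, y); (x, z); (y, z)])].

Definition is_TT3_packing (n : nat) (T : {set 'I_n * 'I_n})
    (P : {set {set 'I_n * 'I_n}}) : bool :=
  [forall A in P, is_TT3 A && (A \subset T)] && trivIset P.

Definition TT3_packing_number (n : nat) (T : {set 'I_n * 'I_n}) : nat :=
  \max_(P : {set {set 'I_n * 'I_n}} | is_TT3_packing T P) #|P|.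

Definition transitive_tournament (n : nat) : {set 'I_n * 'I_n} :=
  [set e : 'I_n * 'I_n | e.1 < e.2].

(* The base point of the arg min in min_TT3_packing has to be a tournament. *)
Lemma transitive_tournamentP (n : nat) : is_tournament (transitive_tournament n).
Proof.
apply/andP; split; first by apply/forallP => x; rewrite inE /= ltnn.
apply/forallP => x; apply/forallP => y; apply/implyP => neq_xy.
by rewrite !inE /=; case: ltngtP => // /val_inj eq_xy; rewrite eq_xy eqxx in neq_xy.
Qed.

Definition min_TT3_packing (n : nat) : nat :=
  TT3_packing_number
    [arg min_(T < transitive_tournament n | is_tournament T)
       TT3_packing_number T].

Lemma min_TT3_packing_le (n : nat) (T : {set 'I_n * 'I_n}) :
  is_tournament T -> min_TT3_packing n <= TT3_packing_number T.
Proof.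
rewrite /min_TT3_packing; case: arg_minnP => [|T0 _ minT0 /minT0 //].
exact: transitive_tournamentP.
Qed.

Lemma min_TT3_packing_attained (n : nat) :
  exists2 T : {set 'I_n * 'I_n},
    is_tournament T & min_TT3_packing n = TT3_packing_number T.
Proof.
rewrite /min_TT3_packing; case: arg_minnP => [|T0 tourT0 _]; last by exists T0.
exact: transitive_tournamentP.
Qed.

(* Main.v *)
(* An integer triangle packing is produced block by block. Take a
   partial linear space on the vertices with 7-point lines covering almost all
   pairs, and put a Fano plane on every line; all the triples so obtained are
   edge-disjoint, so it remains to make many of them transitive. Among the
   Fano planes on a 7-vertex tournament with t transitive triples, one has at
   least (t + 12) / 7 transitive lines: this is the line through the points
   (23, 5) and (30, 6), checked by enumerating the 7-vertex tournaments with
   nonincreasing scores. Placing the partial linear space at random gives t an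
   expectation of at least 35 * 3/4 - o(1), hence (26.25 + 12) / 7 > 5.464
   transitive lines per block, and with almost n^2 / 42 blocks a packing of
   size more than 0.1301 n^2. The excess over 0.13 n^2 allows eps = 0.

   The partial linear spaces are transversal designs TD(7, m), with the
   construction repeated inside each of the 7 groups.

   Sums of d * (d - 1) over the out-degrees d stand for 2 t throughout, which
   explains the doubled constants 24 and 14. *)
Require Import Defs.
From mathcomp Require Import all_boot all_order all_fingroup all_algebra.
From mathcomp Require Import all_classical all_reals all_analysis.
From mathcomp Require Import zify lra.
Import Order.TTheory GRing.Theory Num.Theory.
Import numFieldNormedType.Exports.
Set Implicit Arguments.
Unset Strict Implicit.
Unset Printing Implicit Defensive.

(** * Exhaustive search over seven-vertex tournaments *)

(** A labelling [p] stands for the Fano plane with lines [p_l, p_(l+1), p_(l+3)], indices mod 7.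
    These ten are enough once the scores are nonincreasing, as the search confirms. *)
Definition fano_labellings : seq (seq nat) :=
  [:: [:: 0; 1; 2; 6; 5; 4; 3]; [:: 0; 1; 2; 4; 6; 3; 5];
      [:: 0; 1; 2; 5; 3; 6; 4]; [:: 0; 1; 3; 2; 4; 6; 5];
      [:: 0; 1; 2; 3; 4; 5; 6]; [:: 0; 1; 3; 2; 6; 5; 4];
      [:: 0; 1; 2; 6; 4; 3; 5]; [:: 0; 1; 2; 4; 6; 5; 3];
      [:: 0; 1; 2; 3; 6; 4; 5]; [:: 0; 1; 2; 4; 5; 3; 6]].

Definition acyclic (V : Type) (e : V -> V -> bool) (x y z : V) : bool :=
  ~~ ((e x y == e y z) && (e y z == e z x)).

Definition fano_acyclic (p : seq nat) (e : nat -> nat -> bool) : nat :=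
  count (fun l => acyclic e (nth 0 p l) (nth 0 p ((l + 1) %% 7))
                            (nth 0 p ((l + 3) %% 7))) (iota 0 7).

(** A tournament is stored as its upper triangle: row [x] starts at the arc from [x] to [x + 1], and
    the lower half is obtained by complement. *)
Definition arc (rows : seq (seq bool)) (x y : nat) : bool :=
  if x < y then nth false (nth [::] rows x) (y - x.+1)
  else ~~ nth false (nth [::] rows y) (x - y.+1).

Fixpoint bitvectors (k : nat) : seq (seq bool) :=
  if k is k'.+1 then
    let s := bitvectors k' in map (cons true) s ++ map (cons false) s
  else [:: [::]].

(* [back] counts, for each remaining vertex, its arcs to the vertices already
   treated, and [w] is the running value of the sum of the [d * d.-1]. *)
Fixpoint search (k : nat) (prev : nat) (back : seq nat) (w : nat)
    (rows : seq (seq bool)) : bool :=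
  let b := head 0 back in
  if k is k'.+1 then
    all (fun r => let d := b + count id r in
      if d <= prev then
      search k' d [seq c.1 + ~~ c.2 | c <- zip (behead back) r]
             (w + d * d.-1) (rcons rows r) else true)
      (bitvectors k)
  else if b <= prev then
    has (fun p => w + b * b.-1 + 24 <= 14 * fano_acyclic p (arc rows))
      fano_labellings
  else true.


(** The initial bound 6 is the largest score possible on seven vertices. Branches where a score
    exceeds the preceding one succeed vacuously. *)
Lemma search_true : search 6 6 (nseq 7 0) 0 [::].
Proof. by vm_compute. Qed.

Lemma mem_bitvectors (r : seq bool) : r \in bitvectors (size r).
Proof.
elim: r => //= b r IHr; rewrite mem_cat.
by case: b; rewrite map_f ?orbT.
Qed.

(** * Tournaments as relations, and the Fano plane with many transitive lines *)

Section Tournament.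
Variables (V : finType) (e : rel V).

Definition tournament_rel : bool :=
  [forall x, ~~ e x x] && [forall x, forall y, (x != y) ==> (e x y (+) e y x)].

Definition outdeg (x : V) : nat := \sum_y e x y.

Lemma tournament_irr x : tournament_rel -> e x x = false.
Proof. by case/andP => /forallP /(_ x) /negbTE. Qed.

Lemma tournament_neg x y : tournament_rel -> x != y -> e x y = ~~ e y x.
Proof.
case/andP => _ /forallP /(_ x) /forallP /(_ y) /implyP h /h.
by case: (e x y); case: (e y x).
Qed.

End Tournament.

(** By induction on [k], following the single branch whose bit vectors are the rows of [E]; along it
    the arguments of [search] are those computed from [E]. Here [d a] is the score of [a], split
    into arcs to smaller and to larger labels. *)
Lemma search_sound (E : nat -> nat -> bool) k i prev :
  let row a := [seq E a j | j <- iota a.+1 (6 - a)] in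
  let d a := \sum_(0 <= b < a) ~~ E b a + count id (row a) in
  i + k = 6 ->
  search k prev [seq \sum_(0 <= b < i) ~~ E b j | j <- iota i k.+1]
    (\sum_(0 <= a < i) d a * (d a).-1) [seq row a | a <- iota 0 i] ->
  d i <= prev -> (forall a, a < 6 -> d a.+1 <= d a) ->
  exists2 p, p \in fano_labellings &
    \sum_(0 <= a < 7) d a * (d a).-1 + 24 <=
    14 * fano_acyclic p (arc [seq row a | a <- iota 0 6]).
Proof.
move=> row d; elim: k i prev => [|k IHk] i prev.
  rewrite addn0 => ->; rewrite /search.
  have -> : head 0 [seq \sum_(0 <= b < 6) ~~ E b j | j <- iota 6 1] = d 6.
    by rewrite /d /= addn0.
  by move=> + le_d _; rewrite le_d => /hasP[p p_in le_p]; exists p; rewrite // big_nat_recr.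
move=> ik; have sz : 6 - i = k.+1 by lia.
rewrite [search _ _ _ _ _]/= => /allP /(_ (row i)).
have -> : row i \in map (cons true) (bitvectors k) ++ map (cons false) (bitvectors k).
  by have := mem_bitvectors (row i); rewrite size_map size_iota sz.
move=> /(_ isT) + le_d le_dS.
rewrite -/(d i) le_d => S.
apply: (IHk i.+1 (d i)) => //; first by lia.
- have -> : [seq row a | a <- iota 0 i.+1] = rcons [seq row a | a <- iota 0 i] (row i).
    by rewrite -[i.+1]addn1 iotaD map_cat cats1.
  move: S; rewrite big_nat_recr //=; congr search.
  rewrite {1}/row sz.
  set f := fun j => \sum_(0 <= b < i) ~~ E b j.
  rewrite -[f i.+1 :: _]/(map f (iota i.+1 k.+1)) zip_map -map_comp.
  rewrite -[RHS]/(map _ (iota i.+1 k.+1)).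
  by apply: eq_map => j /=; rewrite big_nat_recr.
- by apply: le_dS; lia.
Qed.

Definition shift7 (k : nat) (l : 'I_7) : 'I_7 := inord ((l + k) %% 7).

Lemma fano_sorted (e : rel 'I_7) :
  tournament_rel e -> {homo outdeg e : i j / i <= j >-> j <= i} ->
  exists s : {perm 'I_7},
    \sum_i outdeg e i * (outdeg e i).-1 + 24 <=
    14 * #|[set l | acyclic e (s l) (s (shift7 1 l)) (s (shift7 3 l))]|.
Proof.
move=> tour_e sorted_e.
pose E i j := e (inord i) (inord j).
pose row a := [seq E a j | j <- iota a.+1 (6 - a)].
pose d a := \sum_(0 <= b < a) ~~ E b a + count id (row a).
have dE (a : nat) : a < 7 -> d a = outdeg e (inord a).
  move=> lt_a7; rewrite /outdeg (eq_bigr (fun y : 'I_7 => E a y : nat)); last first.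
    by move=> y _; rewrite /E inord_val.
  rewrite -(big_mkord predT (fun y => E a y : nat)) (@big_cat_nat _ _ _ a) //;
    last exact: ltnW.
  rewrite [X in _ = _ + X]big_ltn // (_ : E a a = false); last exact: tournament_irr.
  rewrite /= add0n; congr (_ + _).
    apply: eq_big_nat => b /andP[_ lt_ba]; rewrite /E tournament_neg ?negbK //.
    by rewrite -val_eqE /= !inordK ?(ltn_trans lt_ba) //; lia.
  by rewrite -sum1_count big_map big_mkcond; apply: eq_bigr => b _; case: (E a b).
have : search 6 6 [seq \sum_(0 <= b < 0) ~~ E b j | j <- iota 0 7]
    (\sum_(0 <= a < 0) d a * (d a).-1) [seq row a | a <- iota 0 0].
  have -> : [seq \sum_(0 <= b < 0) ~~ E b j | j <- iota 0 7] = nseq 7 0.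
    by rewrite (eq_map (g := fun=> 0)) // => j; rewrite big_geq.
  rewrite big_geq; first exact: search_true.
  by [].
case/(search_sound (E := E)); first by [].
(* The first score respects the initial bound: a vertex has at most 6 out-neighbours, being none of
   its own. *)
- rewrite -/(d 0) dE //; rewrite /outdeg.
  apply: leq_trans (_ : \sum_(y in [set~ inord 0]) 1 <= _).
    rewrite [leqRHS]big_mkcond; apply: leq_sum => y _; rewrite !inE.
    by case: eqP => [->|_]; rewrite ?tournament_irr //=; case: (e _ _).
  by rewrite sum1_card cardsC1 card_ord.
- by move=> a lt_a6; rewrite -/(d _) -/(d _) !dE ?sorted_e ?inordK //; lia.
move=> p p_in le_p.
(* Evaluating the table shows that each labelling permutes 0, ..., 6. *)
have /and3P[uniq_p /eqP size_p /allP lt_p] :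
    [&& uniq p, size p == 7 & all (fun x => x < 7) p].
  by move: p_in {le_p}; apply/allP: p; vm_compute.
pose f (l : 'I_7) : 'I_7 := inord (nth 0 p l).
have fE (l : 'I_7) : f l = nth 0 p l :> nat.
  by rewrite inordK // lt_p // mem_nth // size_p.
have f_inj : injective f.
  move=> l m /(congr1 val); rewrite /= !fE => /eqP.
  by rewrite nth_uniq ?size_p // => /eqP /val_inj.
exists (perm f_inj).
rewrite (_ : \sum_i _ = \sum_(0 <= a < 7) d a * (d a).-1); last first.
  by rewrite big_mkord; apply: eq_bigr => i _; rewrite dE ?inord_val.
apply: leq_trans le_p _; rewrite leq_mul2l /fano_acyclic.
rewrite -sum1_count -sum1_card big_mkcond.
rewrite -[iota 0 7]/(index_iota 0 7) big_mkord [leqRHS]big_mkcond.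
apply: leq_sum => l _; rewrite inE !permE.
have arcE (i j : 'I_7) : i != j -> arc [seq row a | a <- iota 0 6] i j = e i j.
  move=> neq_ij; have neq : val i != val j by [].
  have nthE (a b : 'I_7) : a < b ->
      nth false (nth [::] [seq row a | a <- iota 0 6] a) (b - a.+1) = e a b.
    move=> lt_ab; have lt_b := ltn_ord b.
    rewrite (nth_map 0) ?size_iota ?nth_iota; try lia.
    rewrite add0n /row (nth_map 0) ?size_iota ?nth_iota; try lia.
    by rewrite subnKC // /E !inord_val.
  rewrite /arc; case: ltnP => [/nthE //|le_ji].
  rewrite nthE; last by rewrite ltn_neqAle eq_sym neq.
  by rewrite (tournament_neg tour_e neq_ij).
have modE k : (inord ((l + k) %% 7) : 'I_7) = (l + k) %% 7 :> nat.
  by apply: inordK; apply: ltn_pmod.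
have neq_f (i j : 'I_7) : i != j :> nat -> f i != f j.
  by move=> neq; rewrite (inj_eq f_inj).
have nthE k : nth 0 p ((l + k) %% 7) = f (inord ((l + k) %% 7)) by rewrite fE modE.
rewrite /acyclic (nthE 1) (nthE 3) -fE !arcE //; apply: neq_f; rewrite !modE.
- by case: (nat_of_ord l) (ltn_ord l) => [|[|[|[|[|[|[|]]]]]]].
- by case: (nat_of_ord l) (ltn_ord l) => [|[|[|[|[|[|[|]]]]]]].
- by case: (nat_of_ord l) (ltn_ord l) => [|[|[|[|[|[|[|]]]]]]].
Qed.

(** Listing the vertices by nonincreasing score reduces this to [fano_sorted]; the labelling found
    there is composed with the sorting permutation. *)
Lemma fano_tournament (e : rel 'I_7) :
  tournament_rel e ->
  exists s : {perm 'I_7},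
    \sum_i outdeg e i * (outdeg e i).-1 + 24 <=
    14 * #|[set l | acyclic e (s l) (s (shift7 1 l)) (s (shift7 3 l))]|.
Proof.
move=> tour_e; pose geq_deg i j := outdeg e j <= outdeg e i.
pose l := sort geq_deg (enum 'I_7).
have size_l : size l = 7 by rewrite size_sort size_enum_ord.
have uniq_l : uniq l by rewrite sort_uniq enum_uniq.
have t_inj : injective (fun i : 'I_7 => nth ord0 l i).
  by move=> i j /eqP; rewrite nth_uniq ?size_l // => /eqP /val_inj.
pose t := perm t_inj.
have degE i : outdeg (relpre t e) i = outdeg e (t i).
  by rewrite [RHS](reindex_inj (@perm_inj _ t)).
have [||s le_s] := @fano_sorted (relpre t e).
- apply/andP; split; first by apply/forallP => x; rewrite /= tournament_irr.
  apply/forallP => x; apply/forallP => y; apply/implyP => neq_xy /=.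
  by rewrite (@tournament_neg _ _ (t x)) ?(inj_eq perm_inj) //; case: (e _ _).
- move=> i j le_ij; rewrite !degE !permE.
  apply: (@sorted_leq_nth _ geq_deg); rewrite ?inE ?size_l //.
  + by move=> y x z le_yx le_zy; apply: leq_trans le_zy le_yx.
  + by move=> x; apply: leqnn.
  + by apply: sort_sorted => x y; apply: leq_total.
exists (s * t)%g; rewrite (reindex_inj (@perm_inj _ t)) /=.
rewrite (eq_bigr (fun i => outdeg (relpre t e) i * (outdeg (relpre t e) i).-1)).
  by apply: leq_trans le_s _; apply/eq_leq; congr (14 * _); apply: eq_card => i;
    rewrite !inE !permM.
by move=> i _; rewrite degE.
Qed.

(** * Dense partial linear spaces with seven-point lines *)

(** Lines come with a labelling of their points, so that relabelling a line chooses the Fano plane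
    placed on it. *)
Definition is_design (n : nat) (J : finType) (b : J -> 'I_7 -> 'I_n) : Prop :=
  (forall j, injective (b j)) /\
  (forall j j' x y x' y', x != y -> b j x = b j' x' -> b j y = b j' y' -> j = j').

(** The first [7 * m] vertices form seven groups of size [m]. The line [(a, d)] meets group [x] in
    [a + d * x] mod [m], which gives [m ^ 2] transversals; a copy of [b] is placed inside each
    group. Two transversals cannot share two points because label differences, between 1 and 6, are
    invertible mod [m]. *)
Lemma design_step (m n : nat) (J : finType) (b : J -> 'I_7 -> 'I_m) :
  is_design b -> coprime m 30 -> 7 * m <= n ->
  exists (J' : finType) (b' : J' -> 'I_7 -> 'I_n),
    is_design b' /\ #|J'| = m ^ 2 + 7 * #|J|.
Proof.
move=> [b_inj b_lin] co_m le_n.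
have m_gt0 : 0 < m by move: co_m; case: m {b b_inj b_lin le_n}.
have pt_lt (i : 'I_7) r : i * m + r %% m < n.
  by move: (ltn_ord i) (ltn_pmod r m_gt0); nia.
pose pt (i : 'I_7) (r : nat) : 'I_n := Ordinal (pt_lt i r).
have ptE i r i' r' : pt i r = pt i' r' -> i = i' /\ r = r' %[mod m].
  move=> /(congr1 val) /= eq_pt; split; last first.
    by have := congr1 (modn^~ m) eq_pt; rewrite /= !modnMDl !modn_mod.
  apply: val_inj; have := congr1 (divn^~ m) eq_pt.
  by rewrite /= !divnMDl // !divn_small ?ltn_pmod // !addn0.
pose b' (j : 'I_m * 'I_m + 'I_7 * J) (x : 'I_7) : 'I_n :=
  match j with
  | inl (a, d) => pt x (a + d * x)
  | inr (i, j) => pt i (b j x)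
  end.
exists ('I_m * 'I_m + 'I_7 * J)%type, b'; split; last first.
  by rewrite card_sum !card_prod !card_ord mulnn.
have line_lt (a d a' d' : 'I_m) (x y : 'I_7) : x < y ->
    a + d * x = a' + d' * x %[mod m] -> a + d * y = a' + d' * y %[mod m] ->
    (a, d) = (a', d').
  move=> lt_xy e1 e2.
  (* The square is needed for the difference 4, which divides [30 ^ 2] but not 30. *)
  have co_yx : coprime m (y - x).
    apply: (@coprime_dvdr _ (30 ^ 2)); last exact: coprimeXr.
    have: 0 < y - x < 7 by move: (ltn_ord y); lia.
    by case: (y - x) => [|[|[|[|[|[|[|]]]]]]].
  have eq_d (d1 d2 : 'I_m) : d1 <= d2 ->
      d2 * (y - x) = d1 * (y - x) %[mod m] -> d1 = d2.
    move=> le_d /eqP; rewrite eqn_mod_dvd ?leq_mul2r ?le_d ?orbT // -mulnBl.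
    rewrite Gauss_dvdl // => /dvdn_leq dvd_d; apply/val_inj/eqP.
    rewrite eqn_leq le_d leqNgt /= -subn_gt0; apply/negP => /dvd_d.
    by rewrite leqNgt (leq_ltn_trans (leq_subr _ _)).
  have eq_dc : d * (y - x) = d' * (y - x) %[mod m].
    apply/eqP; rewrite -(eqn_modDl (a + d * x)) -addnA -mulnDr subnKC 1?ltnW // e2.
    by rewrite -(modnDml (a + d * x)) e1 modnDml -addnA -mulnDr subnKC 1?ltnW.
  have dd' : d = d' by case: (leqP d d') => [/eq_d -> //|/ltnW /eq_d <-].
  move: e1 => /eqP; rewrite dd' eqn_modDr !modn_small // => /eqP /val_inj -> //.
split.
- case=> [[a d]|[i j]] x y /ptE[] //= _.
  by rewrite !modn_small // => /val_inj /b_inj.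
- case=> [[a d]|[i j]] [[a' d']|[i' j']] x y x' y' neq_xy /ptE[eq_x +] /ptE[eq_y +].
  + subst x' y'; case: (ltngtP x y) => [lt_xy|lt_yx|/val_inj eq_xy] e1 e2.
    * by congr inl; apply: line_lt lt_xy _ _.
    * by congr inl; apply: line_lt lt_yx _ _.
    * by rewrite eq_xy eqxx in neq_xy.
  (* Distinct points of a transversal lie in different groups, whereas a copy of [b] stays in one
     group. *)
  + by rewrite eq_x eq_y eqxx in neq_xy.
  + subst x' y' => e1 e2; case/eqP: neq_xy; apply: (b_inj j).
    by apply: val_inj; move: e1; rewrite -e2 !modn_small.
  + rewrite !modn_small // => /val_inj e1 /val_inj e2.
    by rewrite eq_x (b_lin _ _ _ _ _ _ neq_xy e1 e2).
Qed.

(** Since 5000 + 7 * 119 = 49 * 119 + 2, a surplus of [2 * m ^ 2] remains. It absorbs the cross term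
    [119 * 14 * m * r], below [350000 * m], and the term in [r ^ 2], because [m] is at least
    280000. *)
Lemma dense_design_step (N m r j : nat) :
  119 * m ^ 2 <= 5000 * j + 119 * N * m -> r < 210 -> 1000 * 280 <= m ->
  119 * (7 * m + r) ^ 2 <= 5000 * (m ^ 2 + 7 * j) + 119 * N * (7 * m + r).
Proof.
move=> le_J lt_r le_m.
have le_mr : m * r <= 209 * m by rewrite mulnC leq_mul2r -ltnS lt_r orbT.
have le_rr : r * r <= 209 * 209 by apply: leq_mul; lia.
have le_mm : 1000 * 280 * m <= m * m by rewrite leq_mul2r le_m orbT.
have sq : (7 * m + r) ^ 2 = 49 * (m * m) + 14 * (m * r) + r * r.
  by rewrite -mulnn; lia.
move: le_J; rewrite sq -mulnn (mulnDr (119 * N)) [119 * N * (7 * m)]mulnCA.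
move: (m * m) (m * r) (r * r) (119 * N * m) (119 * N * r) le_mr le_rr le_mm.
lia.
Qed.

(* Any a < 1/42 could replace 119 / 5000: the recursion m = n / 7 needs
   1 + 7 a > 49 a, and the linear term makes the bound void for n <= N. *)
Lemma dense_design (N n : nat) :
  1000 * 2000 <= N ->
  exists (J : finType) (b : J -> 'I_7 -> 'I_n),
    is_design b /\ 119 * n ^ 2 <= 5000 * #|J| + 119 * N * n.
Proof.
move=> le_N; elim/ltn_ind: n => n IHn.
case: (leqP n N) => [le_nN|lt_Nn].
  exists void, (fun j : void => match j with end); split; first by split; case.
  by rewrite card_void muln0 add0n -mulnn mulnA leq_mul2r leq_mul2l le_nN !orbT.
(* Taking [m] congruent to 1 mod 30 makes it coprime to 30 and leaves fewer than 210 vertices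
   outside the groups, as [7 * m = 210 * q + 7]. *)
pose q := (n - 7) %/ 210; pose r := (n - 7) %% 210; pose m := q * 30 + 1.
have n_eq : n = 7 * m + r by move: (divn_eq (n - 7) 210); rewrite -/q -/r /m; lia.
have lt_r : r < 210 by apply: ltn_pmod.
have lt_mn : m < n by lia.
have [J [b [b_design le_J]]] := IHn m lt_mn.
have co_m : coprime m 30 by rewrite /coprime gcdnC gcdnMDl.
have [|J' [b' [b'_design J'_card]]] := @design_step m n J b b_design co_m; first by lia.
exists J', b'; split=> //; rewrite J'_card n_eq.
have le_m : 1000 * 280 <= m by lia.
exact: dense_design_step le_J lt_r le_m.
Qed.

(** * Counting out-wedges and averaging over permutations *)

Lemma wedge_sum (V : finType) (e : rel V) (x : V) :
  e x x = false ->
  \sum_(y | y != x) \sum_(z | (z != x) && (z != y)) e x y * e x z =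
  outdeg e x * (outdeg e x).-1.
Proof.
move=> irr; have outE : outdeg e x = \sum_(y | y != x) e x y.
  by rewrite /outdeg (bigD1 x) //= irr.
have -> : outdeg e x * (outdeg e x).-1 = outdeg e x * outdeg e x - outdeg e x.
  by case: outdeg => //= d; rewrite mulnS addnC addnK.
(* Adding the diagonal pairs [y = z] completes the sum to the square of the score. *)
rewrite -[LHS](addnK (outdeg e x)); congr (_ - _).
rewrite {1}outE -big_split [X in X * _]outE big_distrl; apply: eq_bigr => y neq_yx /=.
rewrite [outdeg e x in RHS]outE [in RHS](bigD1 y) //= mulnDr big_distrr addnC.
by congr (_ + _); case: (e x y).
Qed.

Definition sum3 (V : finType) (g : V -> V -> V -> nat) : nat :=
  \sum_x \sum_(y | y != x) \sum_(z | (z != x) && (z != y)) g x y z.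

Lemma eq_sum3 (V : finType) (g h : V -> V -> V -> nat) :
  (forall x y z, y != x -> z != x -> z != y -> g x y z = h x y z) ->
  sum3 g = sum3 h.
Proof.
move=> eq_gh; apply: eq_bigr => x _; apply: eq_bigr => y neq_yx.
by apply: eq_bigr => z /andP[neq_zx neq_zy]; apply: eq_gh.
Qed.

Lemma sum3_const (V : finType) (c : nat) :
  sum3 (fun _ _ _ : V => c) = #|V| * (#|V| - 1) * (#|V| - 2) * c.
Proof.
rewrite -!mulnA -sum_nat_const; apply: eq_bigr => x _.
have -> : #|V| - 1 = #|[set~ x]| by rewrite cardsC1 subn1.
rewrite -sum_nat_const; apply: eq_big => [y|y neq_yx]; first by rewrite !inE.
have -> : #|V| - 2 = #|~: [set x; y]|.
  by rewrite cardsCs finset.setCK cards2 eq_sym neq_yx.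
by rewrite -sum_nat_const; apply: eq_bigl => z; rewrite !inE negb_or.
Qed.

Lemma sum3_perm (V : finType) (g : V -> V -> V -> nat) (s : {perm V}) :
  sum3 (fun x y z => g (s x) (s y) (s z)) = sum3 g.
Proof.
rewrite /sum3 [RHS](reindex_inj (@perm_inj _ s)); apply: eq_bigr => x _.
rewrite [RHS](reindex_inj (@perm_inj _ s)).
apply: eq_big => y; first by rewrite (inj_eq perm_inj).
move=> _; rewrite [RHS](reindex_inj (@perm_inj _ s)).
by apply: eq_bigl => z; rewrite !(inj_eq perm_inj).
Qed.

Lemma exchange_sum3 (I V : finType) (g : I -> V -> V -> V -> nat) :
  \sum_i sum3 (g i) = sum3 (fun x y z => \sum_i g i x y z).
Proof.
rewrite exchange_big; apply: eq_bigr => x _.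
by rewrite exchange_big; apply: eq_bigr => y _; rewrite exchange_big.
Qed.

Lemma perm_triple_exists (V : finType) (a b c x y z : V) :
  b != a -> c != a -> c != b -> y != x -> z != x -> z != y ->
  exists s : {perm V}, [/\ s a = x, s b = y & s c = z].
Proof.
move=> ba ca cb yx zx zy.
pose s1 := tperm a x; have s1a : s1 a = x by apply: tpermL.
have s1b : s1 b != x by rewrite -s1a (inj_eq perm_inj).
pose s2 := (s1 * tperm (s1 b) y)%g.
have s2a : s2 a = x by rewrite permM s1a tpermD.
have s2b : s2 b = y by rewrite permM tpermL.
have s2cx : s2 c != x by rewrite -s2a (inj_eq perm_inj).
have s2cy : s2 c != y by rewrite -s2b (inj_eq perm_inj).
exists (s2 * tperm (s2 c) z)%g.
by split; rewrite permM ?s2a ?s2b ?tpermL ?tpermD.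
Qed.

(** A uniformly random permutation sends a fixed triple of distinct points to a uniformly random
    one: by 3-transitivity and translation in the group, the sum over [s] is the same for every such
    triple. *)
Lemma sum_perm_triple (V : finType) (g : V -> V -> V -> nat) (a b c : V) :
  b != a -> c != a -> c != b ->
  #|V| * (#|V| - 1) * (#|V| - 2) * \sum_(s : {perm V}) g (s a) (s b) (s c) =
  #|{perm V}| * sum3 g.
Proof.
move=> ba ca cb; rewrite -sum3_const -[RHS]sum_nat_const.
rewrite -(eq_bigr _ (fun s _ => sum3_perm g s)) exchange_sum3.
apply: eq_sum3 => x y z yx zx zy.
have [t [<- <- <-]] := perm_triple_exists ba ca cb yx zx zy.
rewrite [RHS](reindex_inj (mulgI t^-1)%g) /=.
by apply: eq_bigr => s _; rewrite !permM !permK.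
Qed.

Lemma sum_wedges (V : finType) (e : rel V) :
  tournament_rel e ->
  sum3 (fun x y z => e x y * e x z) = \sum_x outdeg e x * (outdeg e x).-1.
Proof.
by move=> tour_e; apply: eq_bigr => x _; apply: wedge_sum; apply: tournament_irr.
Qed.

Lemma sum_outdeg (V : finType) (e : rel V) :
  tournament_rel e -> 2 * \sum_x outdeg e x = #|V| * (#|V| - 1).
Proof.
move=> tour_e; rewrite mul2n -addnn [X in X + _]exchange_big -big_split /=.
rewrite -sum_nat_const; apply: eq_bigr => x _.
rewrite /outdeg -big_split /= subn1 -(cardsC1 x) -sum1_card [RHS]big_mkcond /=.
apply: eq_bigr => y _; rewrite !inE; case: eqP => [->|/eqP neq_yx].
  by rewrite tournament_irr.
by rewrite (tournament_neg tour_e neq_yx); case: (e x y).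
Qed.

(** A transitive triple has one source and yields two ordered out-wedges, a cyclic triple none. The
    bound thus says that asymptotically at least 3/4 of all triples are transitive, by convexity in
    the scores. *)
Lemma wedges_lower_bound (V : finType) (e : rel V) :
  tournament_rel e ->
  #|V| * (#|V| - 1) ^ 2 <=
  4 * sum3 (fun x y z => e x y * e x z) + 2 * (#|V| * (#|V| - 1)).
Proof.
move=> tour_e; rewrite sum_wedges //; set k := #|V| - 1.
have sumd := sum_outdeg tour_e; rewrite -/k in sumd.
(* Termwise this is [(2 * d - k) ^ 2 >= 0], where [k / 2] is the mean score. *)
have : \sum_x (4 * outdeg e x * k) <=
  \sum_x (4 * (outdeg e x * (outdeg e x).-1) + k ^ 2 + 4 * outdeg e x).
  apply: leq_sum => x _; move: (outdeg e x) => d.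
  case: (leqP k (2 * d)) => h; case: d h => [|d] h /=; nia.
have sum4 (F : V -> nat) : \sum_x 4 * F x = 4 * \sum_x F x by rewrite big_distrr.
have sumk : \sum_(x : V) k ^ 2 = #|V| * k ^ 2 by rewrite sum_nat_const.
rewrite !big_split /= sumk -big_distrl /= sum4 !big1_eq.
have -> : 4 * (\sum_x outdeg e x) * k = 2 * (#|V| * (k * k)).
  by rewrite [#|V| * _]mulnA -sumd; lia.
move: sumd; rewrite -mulnn; clear.
move: (\sum_x outdeg e x * (outdeg e x).-1) (\sum_x outdeg e x) #|V|.
lia.
Qed.

(** * From designs to packings of transitive triples *)

Definition fano_line (l : 'I_7) : {set 'I_7} :=
  [set l; shift7 1 l; shift7 3 l].

(** The set {0, 1, 3} is a perfect difference set mod 7; the claim is checked over all residues. *)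
Lemma fano_line_lin (l m x y : 'I_7) :
  x != y -> x \in fano_line l -> y \in fano_line l ->
  x \in fano_line m -> y \in fano_line m -> l = m.
Proof.
pose L (l : nat) := [:: l; (l + 1) %% 7; (l + 3) %% 7].
have inL (i k : 'I_7) : (i \in fano_line k) = (val i \in L k).
  by rewrite !inE -!val_eqE /= !inordK ?ltn_pmod // orbA.
rewrite !inL -val_eqE => xy xl yl xm ym; apply/val_inj.
have chk : all (fun l => all (fun m => all (fun x => all (fun y =>
  [|| x == y, x \notin L l, y \notin L l, x \notin L m, y \notin L m | l == m])
  (iota 0 7)) (iota 0 7)) (iota 0 7)) (iota 0 7) by vm_compute.
have in7 (i : 'I_7) : val i \in iota 0 7 by rewrite mem_iota ltn_ord.
move: chk => /allP /(_ _ (in7 l)) /allP /(_ _ (in7 m)).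
move=> /allP /(_ _ (in7 x)) /allP /(_ _ (in7 y)).
by rewrite (negbTE xy) xl yl xm ym => /eqP.
Qed.

Section Packing.
Variables (n : nat) (T : {set 'I_n * 'I_n}).

Definition edge_rel : rel 'I_n := fun x y => (x, y) \in T.

Lemma edge_rel_tournament : is_tournament T -> tournament_rel edge_rel.
Proof. by []. Qed.

(** Six of the eight orientations of a triangle are acyclic, one for each linear order of its
    vertices; [key] handles the order [u], [v], [w] from source to sink. *)
Lemma acyclic_TT3 (x y z : 'I_n) :
  is_tournament T -> y != x -> z != x -> z != y -> acyclic edge_rel x y z ->
  is_TT3 [set p in T | (p.1 \in [set x; y; z]) && (p.2 \in [set x; y; z])].
Proof.
move=> tourT.
have key u v w : uniq [:: u; v; w] -> (u, v) \in T -> (u, w) \in T -> (v, w) \in T ->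
    forall A : {set 'I_n}, A =i [:: u; v; w] ->
    is_TT3 [set p in T | (p.1 \in A) && (p.2 \in A)].
  move=> uniq_uvw uv uw vw A A_def.
  apply/existsP; exists u; apply/existsP; exists v; apply/existsP; exists w.
  rewrite uniq_uvw; apply/eqP/setP => -[p q].
  have tour := edge_rel_tournament tourT.
  have irr a : ((a, a) \in T) = false := tournament_irr a tour.
  have anti a b : (a, b) \in T -> ((b, a) \in T) = false.
    move=> ab; case: (eqVneq b a) => [-> //|neq_ba].
    by rewrite -[_ \in T]/(edge_rel b a) (tournament_neg tour neq_ba) /edge_rel ab.
  move: uniq_uvw; rewrite /= !inE !A_def !inE /= !xpair_eqE.
  rewrite negb_or andbT => /andP[/andP[nuv nuw] nvw].
  have [nvu nwu nwv] : [/\ v != u, w != u & w != v] by split; rewrite eq_sym.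
  have [vu wu wv] := And3 (anti _ _ uv) (anti _ _ uw) (anti _ _ vw).
  case: (eqVneq p u) => [->|_];
    [|case: (eqVneq p v) => [->|_]; [|case: (eqVneq p w) => [->|_]]];
  (case: (eqVneq q u) => [->|_];
    [|case: (eqVneq q v) => [->|_]; [|case: (eqVneq q w) => [->|_]]]);
  by rewrite ?irr ?uv ?uw ?vw ?vu ?wu ?wv ?(negbTE nuv) ?(negbTE nuw) ?(negbTE nvw)
     ?(negbTE nvu) ?(negbTE nwu) ?(negbTE nwv) /= ?andbT ?andbF ?orbF.
move=> yx zx zy; have tour := edge_rel_tournament tourT.
have neqs : (x != y) * (x != z) * (y != z) * (y != x) * (z != x) * (z != y).
  by do !split; rewrite // eq_sym.
rewrite /acyclic; have := tournament_neg tour yx; have := tournament_neg tour zy.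
have := tournament_neg tour zx; rewrite /edge_rel.
case xy: ((x, y) \in T); case yz: ((y, z) \in T); case xz: ((x, z) \in T) => //= zxE zyE yxE;
  rewrite ?zxE // => _.
- apply: (key x y z); [by rewrite /= !inE !negb_or ?neqs | by [] | by [] | by [] |].
  by move=> v; rewrite !inE; do 3 case: eqP => //.
- apply: (key x z y); [by rewrite /= !inE !negb_or ?neqs | by [] | by [] | by [] |].
  by move=> v; rewrite !inE; do 3 case: eqP => //.
- apply: (key z x y); [by rewrite /= !inE !negb_or ?neqs | by [] | by [] | by [] |].
  by move=> v; rewrite !inE; do 3 case: eqP => //.
- apply: (key y x z); [by rewrite /= !inE !negb_or ?neqs | by [] | by [] | by [] |].
  by move=> v; rewrite !inE; do 3 case: eqP => //.
- apply: (key y z x); [by rewrite /= !inE !negb_or ?neqs | by [] | by [] | by [] |].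
  by move=> v; rewrite !inE; do 3 case: eqP => //.
- apply: (key z y x); [by rewrite /= !inE !negb_or ?neqs | by [] | by [] | by [] |].
  by move=> v; rewrite !inE; do 3 case: eqP => //.
Qed.

(* Distinct (block, line) pairs span edge-disjoint triples, since two points
   determine both the block and the line. *)
Lemma design_packing (J : finType) (b : J -> 'I_7 -> 'I_n) :
  is_tournament T -> is_design b ->
  \sum_j #|[set l | acyclic (relpre (b j) edge_rel) l (shift7 1 l) (shift7 3 l)]|
    <= TT3_packing_number T.
Proof.
move=> tourT [b_inj b_lin].
pose line (jl : J * 'I_7) := b jl.1 @: fano_line jl.2.
pose TT jl := [set p in T | (p.1 \in line jl) && (p.2 \in line jl)].
pose A := [set jl : J * 'I_7 |
  acyclic (relpre (b jl.1) edge_rel) jl.2 (shift7 1 jl.2) (shift7 3 jl.2)].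
have TT3 jl : jl \in A -> is_TT3 (TT jl).
  rewrite inE => acyc; rewrite /TT.
  have -> : line jl = [set b jl.1 jl.2; b jl.1 (shift7 1 jl.2); b jl.1 (shift7 3 jl.2)].
    by rewrite /line /fano_line !imsetU !imset_set1.
  have shiftE k : shift7 k jl.2 = (jl.2 + k) %% 7 :> nat by apply/inordK/ltn_pmod.
  apply: acyclic_TT3 => //; rewrite (inj_eq (b_inj _)) -val_eqE /= ?shiftE;
  by case: (nat_of_ord jl.2) (ltn_ord jl.2) => [|[|[|[|[|[|[|]]]]]]].
have TT_inj jl jl' p : p \in TT jl -> p \in TT jl' -> jl = jl'.
  case: jl jl' p => [j l] [j' l'] [x y]; rewrite !inE /=.
  case/and3P => Txy /imsetP[u ul xu] /imsetP[v vl yv].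
  case/and3P => _ /imsetP[u' ul' xu'] /imsetP[v' vl' yv'].
  have neq_uv : u != v.
    apply: contraTneq Txy => eq_uv; rewrite xu yv eq_uv.
    by rewrite -[_ \in _]/(edge_rel _ _) tournament_irr.
  have eq_u : b j u = b j' u' by exact: etrans (esym xu) xu'.
  have eq_v : b j v = b j' v' by exact: etrans (esym yv) yv'.
  have eq_j := b_lin _ _ _ _ _ _ neq_uv eq_u eq_v; subst j'; congr pair.
  apply: (fano_line_lin neq_uv) => //; first by rewrite (b_inj j u u').
  by rewrite (b_inj j v v').
have TT_neq0 jl : jl \in A -> exists p, p \in TT jl.
  move=> /TT3 /existsP[x /existsP[y /existsP[z /andP[_ /eqP ->]]]].
  by exists (x, y); rewrite !inE eqxx.
(* Disjointness alone would allow empty sets to coincide; being nonempty, the triples are distinct,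
   so the image has as many members as [A]. *)
have TT_injA : {in A &, injective TT}.
  move=> jl jl' /TT_neq0[p p_in] _ eq_TT.
  by apply: (TT_inj _ _ p) => //; rewrite -eq_TT.
have -> : \sum_j #|[set l | acyclic (relpre (b j) edge_rel) l (shift7 1 l) (shift7 3 l)]|
    = #|TT @: A|.
  rewrite card_in_imset // -[RHS]sum1_card [RHS]big_mkcond.
  transitivity (\sum_j \sum_l (if (j, l) \in A then 1 else 0)).
    apply: eq_bigr => j _; rewrite -sum1_card big_mkcond.
    by apply: eq_bigr => l _; rewrite !inE.
  by rewrite pair_bigA; apply: eq_bigr => -[].
apply: (@leq_bigmax_cond _ (is_TT3_packing T)).
apply/andP; split.
  apply/forall_inP => _ /imsetP[jl jl_in ->]; rewrite TT3 //=.
  by apply/fintype.subsetP => p; rewrite inE => /andP[].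
apply/finset.trivIsetP => _ _ /imsetP[jl _ ->] /imsetP[jl' _ ->] neq.
rewrite -finset.setI_eq0; apply: contraR neq => /finset.set0Pn[p /finset.setIP[p_in p_in']].
by rewrite (TT_inj _ _ _ p_in p_in').
Qed.

End Packing.

Lemma tournament_relpre (U V : finType) (f : U -> V) (e : rel V) :
  injective f -> tournament_rel e -> tournament_rel (relpre f e).
Proof.
move=> f_inj tour_e; apply/andP; split.
  by apply/forallP => x; rewrite /= tournament_irr.
apply/forallP => x; apply/forallP => y; apply/implyP => neq_xy /=.
by rewrite (@tournament_neg _ _ (f x)) ?(inj_eq f_inj) //; case: (e _ _).
Qed.

(** Each line receives the labelling that [fano_tournament] provides for the tournament induced on
    it; relabelling within lines keeps the design property. *)
Lemma design_weight (n : nat) (T : {set 'I_n * 'I_n}) (J : finType)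
    (b : J -> 'I_7 -> 'I_n) :
  is_tournament T -> is_design b ->
  \sum_j (sum3 (fun x y z => edge_rel T (b j x) (b j y) * edge_rel T (b j x) (b j z)) + 24)
    <= 14 * TT3_packing_number T.
Proof.
move=> tourT [b_inj b_lin]; have tour_e := edge_rel_tournament tourT.
have tour_b j : tournament_rel (relpre (b j) (edge_rel T)) by apply: tournament_relpre.
have [s le_s] := fin_all_exists (fun j => fano_tournament (tour_b j)).
pose b' j x := b j (s j x).
have b'_design : is_design b'.
  split=> [j x y /b_inj /perm_inj //|j j' x y x' y' neq_xy].
  by apply: b_lin; rewrite (inj_eq perm_inj).
apply: leq_trans (leq_mul (leqnn 14) (design_packing tourT b'_design)).
rewrite big_distrr; apply: leq_sum => j _.
by apply: leq_trans (le_s j); rewrite -(sum_wedges (tour_b j)).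
Qed.

Lemma sum_nat_const_type (I : finType) (c : nat) : \sum_(i : I) c = #|I| * c.
Proof. by rewrite sum_nat_const. Qed.

(** [design_weight] is summed over all images of the design under permutations of the vertices. Both
    sides carry the number of permutations as a factor, cancelled at the end, so the average needs
    no division. *)
Lemma design_average (n : nat) (T : {set 'I_n * 'I_n}) (J : finType)
    (b : J -> 'I_7 -> 'I_n) :
  is_tournament T -> is_design b ->
  #|J| * (24 * (n * (n - 1) * (n - 2)) +
          210 * sum3 (fun x y z => edge_rel T x y * edge_rel T x z))
    <= 14 * (n * (n - 1) * (n - 2)) * TT3_packing_number T.
Proof.
move=> tourT [b_inj b_lin]; pose g x y z := edge_rel T x y * edge_rel T x z.
set N3 := n * (n - 1) * (n - 2); set nu := TT3_packing_number T.
have perms_gt0 : 0 < #|{perm 'I_n}| by apply/card_gt0P; exists 1%g.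
rewrite -(leq_pmul2l perms_gt0).
have weight (s : {perm 'I_n}) :
    \sum_j (sum3 (fun x y z => g (s (b j x)) (s (b j y)) (s (b j z))) + 24) <= 14 * nu.
  apply: (design_weight (b := fun j x => s (b j x)) tourT); split.
    by move=> j x y /perm_inj /b_inj.
  by move=> j j' x y x' y' neq_xy /perm_inj e1 /perm_inj; apply: b_lin e1.
(* A line has 7 * 6 * 5 = 210 ordered triples of distinct points, all with the same average. *)
have block j : N3 * \sum_(s : {perm 'I_n})
      sum3 (fun x y z => g (s (b j x)) (s (b j y)) (s (b j z))) =
    210 * (#|{perm 'I_n}| * sum3 g).
  rewrite (exchange_sum3 (fun (s : {perm 'I_n}) x y z =>
    g (s (b j x)) (s (b j y)) (s (b j z)))).
  transitivity (sum3 (fun _ _ _ : 'I_7 => #|{perm 'I_n}| * sum3 g)); last first.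
    by rewrite sum3_const card_ord.
  rewrite /sum3 big_distrr; apply: eq_bigr => x _.
  rewrite big_distrr; apply: eq_bigr => y neq_yx.
  rewrite big_distrr; apply: eq_bigr => z /andP[neq_zx neq_zy].
  have := @sum_perm_triple _ g (b j x) (b j y) (b j z).
  by rewrite !(inj_eq (b_inj j)) card_ord; apply.
have := @leq_sum _ (index_enum _) predT _ _ (fun s _ => weight s).
rewrite sum_nat_const_type exchange_big /= => /(leq_mul (leqnn N3)).
rewrite big_distrr /=.
rewrite (eq_bigr (fun=> 210 * (#|{perm 'I_n}| * sum3 g) +
    N3 * (#|{perm 'I_n}| * 24))); last first.
  by move=> j _; rewrite big_split /= mulnDr block sum_nat_const_type.
rewrite sum_nat_const_type -/g => le_J.
move: N3 nu (sum3 g) #|J| #|{perm 'I_n}| le_J {weight block perms_gt0} => N3 nu G j p le_J.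
by apply: leq_trans (leq_trans _ le_J) _; apply/eq_leq; lia.
Qed.

(** * Numerical conclusion *)

Lemma packing_density (N n J nu : nat) :
  0 < N -> 1000 * 1000 * N <= n ->
  119 * n ^ 2 <= 5000 * J + 119 * N * n ->
  J * (96 * (n - 2) + 210 * (n - 3)) <= 56 * (n - 2) * nu ->
  13 * n ^ 2 < 100 * nu.
Proof.
move=> N_gt0 le_n le_J le_nu; rewrite ltnNge; apply/negP => le_n2.
have n_gt : 1000 * 1000 <= n by rewrite (leq_trans _ le_n) // leq_pmulr.
have le_Nn : 25 * (119 * N * n) <= n ^ 2.
  by rewrite -mulnn mulnA leq_mul2r; apply/orP; right; lia.
(* Scaled by 25, the main coefficient is 2975, and the term linear in [n] costs at most one unit of
   it. *)
have le_Jn : 2974 * n ^ 2 <= 5000 * (25 * J).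
  move: le_J le_Nn; move: (n ^ 2) (119 * N * n) => a b; clear; lia.
have n2_gt0 : 0 < n ^ 2 by rewrite expn_gt0; lia.
have [m nE] : exists m, n = m + 3 by exists (n - 3); lia.
have lt_m : 100 * 1000 <= m by lia.
move: le_nu le_n2 le_Jn n2_gt0; rewrite nE addnK.
have -> : m + 3 - 2 = m.+1 by lia.
move: ((m + 3) ^ 2) => a le_nu le_n2 le_Jn a_gt0.
have h1 := leq_mul le_Jn (leqnn (96 * m.+1 + 210 * m)).
have h2 := leq_mul (leqnn (56 * m.+1)) le_n2.
(* Here 728 = 56 * 13 and 1250 = 125000 / 100. The contradiction comes from 2974 * 306 = 910044 >
   910000 = 728 * 1250, a margin of 44 per unit of [m] that beats the constant terms for large
   [m]. *)
have h : a * (2974 * (96 * m.+1 + 210 * m)) <= a * (728 * 1250 * m.+1).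
  move: h1 h2 le_nu; clear; move: (a * m) (m * nu) (J * m) => *; lia.
move: h; rewrite leq_mul2l -[a == 0]negbK -lt0n a_gt0 /=.
move: lt_m; clear; lia.
Qed.

Local Open Scope classical_set_scope.
Local Open Scope ring_scope.

Lemma min_TT3_packing_lower (N n : nat) :
  (1000 * 2000 <= N)%N -> (2 < n)%N ->
  exists J : nat,
   (119 * n ^ 2 <= 5000 * J + 119 * N * n)%N /\
   (J * (96 * (n - 2) + 210 * (n - 3)) <= 56 * (n - 2) * min_TT3_packing n)%N.
Proof.
move=> le_N lt_2n; have [J [b [b_design le_J]]] := dense_design n le_N.
exists #|J|; split=> //.
have [T tourT ->] := min_TT3_packing_attained n.
have avg := design_average tourT b_design.
have := wedges_lower_bound (edge_rel_tournament tourT).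
move: avg; rewrite card_ord.
move: (TT3_packing_number T) (sum3 _) #|J| => nu G j avg le_G.
have n1_gt0 : (0 < n * (n - 1))%N by rewrite muln_gt0; lia.
rewrite -(leq_pmul2l n1_gt0).
apply: leq_trans (_ : 4 * (j * (24 * (n * (n - 1) * (n - 2)) + 210 * G)) <= _)%N; last by lia.
(* In this form the wedge bound shares the factor [n * (n - 1)] with the averaged inequality, which
   then cancels. *)
have le_G4 : (n * (n - 1) * (n - 3) <= 4 * G)%N.
  have -> : (n * (n - 1) * (n - 3) = n * (n - 1) ^ 2 - 2 * (n * (n - 1)))%N.
    by rewrite -mulnn; nia.
  lia.
rewrite mulnCA [X in (_ <= X)%N]mulnCA leq_mul2l; apply/orP; right.
lia.
Qed.

Theorem theorem1p2 (R : realType) :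
  exists2 eps : nat -> R,
    eps n @[n --> \oo] --> (0 : R) &
    \forall n \near \oo,
      (13 / 100) * n%:R ^+ 2 * (1 + eps n) < (min_TT3_packing n)%:R :> R.
Proof.
exists (fun=> 0); first exact: cvg_cst.
have [N le_N] : exists N, (1000 * 2000 <= N)%N.
  exact: (ex_intro (fun N => (1000 * 2000 <= N)%N) _ (leqnn _)).
exists (1000 * 1000 * N)%N => // n /= le_n.
have N_gt0 : (0 < N)%N by lia.
have [|J [le_J le_nu]] := @min_TT3_packing_lower N n le_N; first by lia.
have := packing_density N_gt0 le_n le_J le_nu; rewrite addr0 mulr1.
by rewrite -(ltr_nat R) !natrM; clear; lra.
Qed.
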